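(* Let $\mathcal{A}\in\mathbb{C}^{I_1\times\cdots\times I_N\times I_1\times\cdots\times I_N}$. Then $\mathcal{A}$ is an invertible tensor with $w(\mathcal{A})\le 1$ and $w(\mathcal{A}^{-1})\le 1$ if and only if $\mathcal{A}$ is unitary.
   Context: For tensors $\mathcal{A},\mathcal{B}\in\mathbb{C}^{I_1\times\cdots\times I_N\times I_1\times\cdots\times I_N}$ the Einstein product is $(\mathcal{A}*_N\mathcal{B})_{i_1\ldots i_Nj_1\ldots j_N}=\sum_{k_1,\ldots,k_N}a_{i_1\ldots i_Nk_1\ldots k_N}b_{k_1\ldots k_Nj_1\ldots j_N}$, and for $\mathcal{X}\in\mathbb{C}^{I_1\times\cdots\times I_N}$, $(\mathcal{A}*_N\mathcal{X})_{i_1\ldots i_N}=\sum_{k_1,\ldots,k_N}a_{i_1\ldots i_Nk_1\ldots k_N}x_{k_1\ldots k_N}$. The identity tensor $\mathcal{I}$ has entries $\prod_{r=1}^N\delta_{i_rj_r}$. $\mathcal{A}$ is invertible if there is $\mathcal{A}^{-1}$ with $\mathcal{A}*_N\mathcal{A}^{-1}=\mathcal{A}^{-1}*_N\mathcal{A}=\mathcal{I}$. The conjugate transpose is $(\mathcal{A}^H)_{i_1\ldots i_Nj_1\ldots j_N}=\overline{a_{j_1\ldots j_Ni_1\ldots i_N}}$, and $\mathcal{A}$ is unitary if $\mathcal{A}^H*_N\mathcal{A}=\mathcal{A}*_N\mathcal{A}^H=\mathcal{I}$. With $\langle\mathcal{X},\mathcal{Y}\rangle=\sum_{i_1,\ldots,i_N}x_{i_1\ldots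 i_N}\overline{y_{i_1\ldots i_N}}$ and $\|\mathcal{X}\|=\langle\mathcal{X},\mathcal{X}\rangle^{1/2}$, the numerical range is $W(\mathcal{A})=\{\langle\mathcal{A}*_N\mathcal{X},\mathcal{X}\rangle:\mathcal{X}\in\mathbb{C}^{I_1\times\cdots\times I_N},\|\mathcal{X}\|=1\}$ and the numerical radius is $w(\mathcal{A})=\max\{|z|:z\in W(\mathcal{A})\}$. *)

(* Defs.v *)
From HB Require Import structures.
From mathcomp Require Import all_boot all_order all_algebra.
From mathcomp Require Import all_classical all_reals all_analysis.
From mathcomp Require Import complex ring lra.

Set Implicit Arguments.
Unset Strict Implicit.
Unset Printing Implicit Defensive.

Import Order.TTheory GRing.Theory Num.Theory.
Import numFieldNormedType.Exports.

Local Open Scope classical_set_scope.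
Local Open Scope ring_scope.

(* Multi-indices (i_1, ..., i_N) with i_k < I_k (0-based), where I_k = d k. *)
Notation midx d := {dffun forall k, 'I_(d k)}.

Section Tensor.
Variables (R : realType) (N : nat) (d : 'I_N -> nat).

Definition tensor := {ffun midx d -> R[i]}.

(* Tensors of order 2N, C^{I_1 x ... x I_N x I_1 x ... x I_N}: an index is the
   pair formed by its first N and its last N components. *)
Definition sqtensor := {ffun midx d * midx d -> R[i]}.

Implicit Types (A B : sqtensor) (X Y : tensor).

Definition einstein A B : sqtensor :=
  [ffun ij : midx d * midx d => \sum_(k : midx d) A (ij.1, k) * B (k, ij.2)].

Definition einstein_app A X : tensor :=
  [ffun i => \sum_(k : midx d) A (i, k) * X k].

Definition idtensor : sqtensor :=
  [ffun ij : midx d * midx d => \prod_(r < N) (ij.1 r == ij.2 r)%:R].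

Definition is_inverse A B : Prop :=
  einstein A B = idtensor /\ einstein B A = idtensor.

Definition invertible_tensor A : Prop := exists B, is_inverse A B.

(* The inverse is unique when it exists; the value is 0 otherwise. *)
Definition tensor_inv A : sqtensor := xget 0 [set B | is_inverse A B].

Definition ctranspose A : sqtensor := [ffun ij : midx d * midx d => ((A (ij.2, ij.1))^*)%C].

Definition unitary_tensor A : Prop :=
  einstein (ctranspose A) A = idtensor /\ einstein A (ctranspose A) = idtensor.

Definition tdot X Y : R[i] := \sum_(i : midx d) X i * ((Y i)^*)%C.

Definition tnorm X : R[i] := sqrtC (tdot X X).

Definition numerical_range A : set R[i] :=
  [set tdot (einstein_app A X) X | X in [set X : tensor | tnorm X = 1]].

(* [ComplexField.Normc.normc] is the R-valued modulus (the norm [`|z|] of R[i]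
   takes its values in R[i]). *)
Definition is_numerical_radius A (r : R) : Prop :=
  let S := [set ComplexField.Normc.normc z | z in numerical_range A] in S r /\ ubound S r.

(* The maximum exists by [numerical_radiusP] when all dimensions are positive. *)
Definition numerical_radius A : R := xget 0 [set r | is_numerical_radius A r].

End Tensor.

Section NumericalRadiusExists.
Variables (R : realType) (N : nat) (d : 'I_N -> nat).
Local Notation n := #|midx d|.
Local Notation V := 'rV[R]_(n + n).

Let ten (v : V) : tensor R d :=
  [ffun i => Complex (v 0 (lshift n (enum_rank i))) (v 0 (rshift n (enum_rank i)))].

Let ccont (g : V -> R[i]) :=
  continuous (fun v => complex.Re (g v)) /\ continuous (fun v => complex.Im (g v)).

Let ccontM g h : ccont g -> ccont h -> ccont (fun v => g v * h v).
Proof.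
move=> [gR gI] [hR hI]; split.
  rewrite (_ : (fun _ => _) = (fun v => complex.Re (g v) * complex.Re (h v)
      - complex.Im (g v) * complex.Im (h v))); last first.
    by apply/funext => v; case: (g v) => a b; case: (h v).
  by move=> v; exact: (cvgB (cvgM (gR v) (hR v)) (cvgM (gI v) (hI v))).
rewrite (_ : (fun _ => _) = (fun v => complex.Re (g v) * complex.Im (h v)
      + complex.Im (g v) * complex.Re (h v))); last first.
  by apply/funext => v; case: (g v) => a b; case: (h v).
by move=> v; exact: (cvgD (cvgM (gR v) (hI v)) (cvgM (gI v) (hR v))).
Qed.

Let ccont_cst z : ccont (fun=> z).
Proof. by split=> v /=; exact: cst_continuous. Qed.

Let ccont_sum (I : finType) (g : I -> V -> R[i]) :
  (forall i, ccont (g i)) -> ccont (fun v => \sum_i g i v).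
Proof.
move=> cg; elim: (index_enum I) => [|i s IH].
  rewrite (_ : (fun _ => _) = (fun=> 0)); first exact: ccont_cst.
  by apply/funext => v; rewrite big_nil.
rewrite (_ : (fun _ => _) = (fun v => g i v + \sum_(j <- s) g j v)); last first.
  by apply/funext => v; rewrite big_cons.
case: IH (cg i) => [sR sI] [gR gI]; split=> v.
  rewrite (_ : (fun _ => _) = (fun v => complex.Re (g i v) +
    complex.Re (\sum_(j <- s) g j v))); last by apply/funext => w; rewrite raddfD.
  exact: (cvgD (gR v) (sR v)).
rewrite (_ : (fun _ => _) = (fun v => complex.Im (g i v) +
    complex.Im (\sum_(j <- s) g j v))); last by apply/funext => w; rewrite raddfD.
exact: (cvgD (gI v) (sI v)).
Qed.

Let ccont_conj g : ccont g -> ccont (fun v => (g v)^*%C).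
Proof.
move=> [gR gI]; split.
  by rewrite (_ : (fun _ => _) = (fun v => complex.Re (g v)))//;
    apply/funext => v; case: (g v).
rewrite (_ : (fun _ => _) = (fun v => - complex.Im (g v))).
  by move=> v; exact: (cvgN (gI v)).
by apply/funext => v; case: (g v).
Qed.

Let ccont_ten i : ccont (fun v => ten v i).
Proof.
split.
  rewrite (_ : (fun _ => _) = fun v : V => v 0 (lshift n (enum_rank i))).
    exact: coord_continuous.
  by apply/funext => v; rewrite ffunE.
rewrite (_ : (fun _ => _) = fun v : V => v 0 (rshift n (enum_rank i))).
  exact: coord_continuous.
by apply/funext => v; rewrite ffunE.
Qed.

Let ccont_dot A : ccont (fun v => tdot (einstein_app A (ten v)) (ten v)).
Proof.
apply: (ccont_sum (g := fun i v => einstein_app A (ten v) i * (ten v i)^*%C)) => i.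
apply: ccontM; last exact/ccont_conj/ccont_ten.
rewrite (_ : (fun _ => _) = (fun v => \sum_k A (i, k) * ten v k)); last first.
  by apply/funext => v; rewrite ffunE.
by apply: (ccont_sum (g := fun k v => A (i, k) * ten v k)) => k; apply: ccontM; [exact: ccont_cst|exact: ccont_ten].
Qed.

Let dot_ten v : tdot (ten v) (ten v) = real_complex R (\sum_j v 0 j ^+ 2).
Proof.
rewrite big_split_ord /= -big_split /= rmorph_sum /=.
rewrite /tdot (reindex (@enum_val _ (midx d))) /=; last first.
  by apply: onW_bij; exact: enum_val_bij.
apply: eq_bigr => j _; rewrite ffunE enum_valK.
by apply/eqP; rewrite eq_complex /= ; apply/andP; split; apply/eqP; ring.
Qed.

Let tnorm_ten v : tnorm (ten v) = 1 <-> \sum_j v 0 j ^+ 2 = 1.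
Proof.
rewrite /tnorm dot_ten; split=> [h|->]; last by rewrite sqrtC1.
have : real_complex R (\sum_j v 0 j ^+ 2) = 1 by rewrite -[LHS]sqrtCK h expr1n.
by case.
Qed.

Let ten_surj X : exists v, ten v = X.
Proof.
exists (row_mx (\row_j complex.Re (X (enum_val j))) (\row_j complex.Im (X (enum_val j)))).
apply/ffunP => i; rewrite ffunE row_mxEl row_mxEr !mxE enum_rankK.
by case: (X i).
Qed.

Lemma numerical_radiusP (A : sqtensor R d) : (forall k, (0 < d k)%N) ->
  is_numerical_radius A (numerical_radius A).
Proof.
move=> d0; apply: (@xgetPex _ 0 [set r | is_numerical_radius A r]).
pose S : set V := [set v | \sum_j v 0 j ^+ 2 = 1].
pose f v := ComplexField.Normc.normc (tdot (einstein_app A (ten v)) (ten v)).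
have S0 : S !=set0.
  pose i0 : midx d := [ffun k => Ordinal (d0 k)].
  exists (delta_mx 0 (lshift n (enum_rank i0))).
  rewrite /S /= (bigD1 (lshift n (enum_rank i0))) //= !mxE !eqxx expr1n.
  by rewrite big1 ?addr0// => j /negbTE ji; rewrite !mxE ji andbF expr0n.
have cS : compact S.
  apply: bounded_closed_compact.
    exists 1; split=> // M M1 v Sv; apply: le_trans (ltW M1).
    rewrite [leLHS]/Num.norm /= mx_normrE; apply/bigmax_leP; split=> [|[i j] _] //=.
    rewrite ord1 -(@ler_pXn2r _ 2) ?nnegrE// expr1n -normrX ger0_norm ?sqr_ge0//.
    by rewrite -Sv (bigD1 j)//= lerDl sumr_ge0// => k _; exact: sqr_ge0.
  rewrite (_ : S = (fun v : V => \sum_j v 0 j ^+ 2) @^-1` [set 1])//.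
  apply: (preimage_closed _ (@closed_eq _ _)) => v _; move: v.
  apply: continuous_big => [|j _ v]; first exact: add_continuous.
  have cj := @coord_continuous R _ _ 0 j v.
  rewrite (_ : (fun _ => _) = (fun x : V => x 0 j * x 0 j)); first exact: (cvgM cj cj).
  by apply/funext => x; rewrite expr2.
have cf : continuous f.
  have [cR cI] := ccont_dot A => v.
  set a := (X in continuous X) in cR; set b := (X in continuous X) in cI.
  rewrite (_ : f = (fun w => Num.sqrt (a w * a w + b w * b w))).
    apply: continuous_cvg; [exact: nbhs_filter|exact: sqrt_continuous|].
    exact: (cvgD (cvgM (cR v) (cR v)) (cvgM (cI v) (cI v))).
  by apply/funext => w; rewrite /f /a /b -!expr2; case: (tdot _ _).
have [v Sv vmax] := EVT_max_rV S0 cS (continuous_subspaceT cf).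
exists (f v); split.
  exists (tdot (einstein_app A (ten v)) (ten v)) => //.
  by exists (ten v) => //; apply/tnorm_ten/set_mem.
move=> _ [_ [X X1 <-] <-]; have [w wX] := ten_surj X; rewrite -wX in X1 *.
by apply: vmax; apply/mem_set/tnorm_ten.
Qed.

End NumericalRadiusExists.

(* Main.v *)
(** Flatten the tensors to matrices acting on row vectors. Every eigenvalue of
    the matrix and of its inverse has modulus at most 1, so the spectrum lies on
    the unit circle. In a Schur triangular form with unimodular diagonal, a
    nonzero off-diagonal entry would push the numerical range of a 2 x 2
    compression outside the unit disc; hence the form is diagonal and unitary.
    The converse is the Cauchy-Schwarz inequality. *)
Require Import Defs.
From mathcomp Require Import all_boot all_order all_algebra.
From mathcomp Require Import all_classical all_reals all_analysis.
From mathcomp Require Import complex ring.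

Set Implicit Arguments.
Unset Strict Implicit.
Unset Printing Implicit Defensive.

Import Order.TTheory GRing.Theory Num.Theory.
Local Open Scope ring_scope.
Local Open Scope sesquilinear_scope.

(** * Matrices whose Hermitian form is bounded by the squared norm *)

Section NumericalContraction.
Variables (C : numClosedFieldType) (n : nat).
Implicit Types (M T P : 'M[C]_n) (x : 'rV[C]_n).

(** Homogeneous version of w(M) <= 1, free of any normalisation of [x]. *)
Definition num_contraction M :=
  forall x, `|(x *m M *m x^t*) 0 0| <= (x *m x^t*) 0 0.

Lemma num_contraction_unitary_similar P M : P \is unitarymx ->
  num_contraction M -> num_contraction (P *m M *m P^t*).
Proof.
move=> /unitarymxP Pu Mc x; have := Mc (x *m P).
have -> : (x *m P)^t* = P^t* *m x^t* by rewrite trmx_mul map_mxM.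
by rewrite !mulmxA -[x *m P *m P^t*]mulmxA Pu mulmx1.
Qed.

(** Cauchy-Schwarz for [x *m M] and [x], which have the same norm. *)
Lemma unitary_num_contraction M : M \is unitarymx -> num_contraction M.
Proof.
move=> /unitarymxP Mu x.
have : `|dotmx (x *m M) x| <=
    sqrtC (dotmx (x *m M) (x *m M)) * sqrtC (dotmx x x).
  exact: (leif_le (CauchySchwarz_sqrt (@dotmx C n) (x *m M) x)).
have -> : dotmx (x *m M) (x *m M) = dotmx x x.
  rewrite !dotmxE.
  have -> : (x *m M)^t* = M^t* *m x^t* by rewrite trmx_mul map_mxM.
  by rewrite !mulmxA -[x *m M *m M^t*]mulmxA Mu mulmx1.
by rewrite -expr2 sqrtCK !dotmxE.
Qed.

(** At an eigenvector the form is [a] times the squared norm. *)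
Lemma eigenvalue_num_contraction M a :
  num_contraction M -> eigenvalue M a -> `|a| <= 1.
Proof.
move=> Mc /eigenvalueP[x xM x0]; have := Mc x.
have xx : 0 < (x *m x^t*) 0 0 by rewrite -dotmxE dnorm_gt0.
rewrite xM -scalemxAl mxE normrM (gtr0_norm xx).
by rewrite -ler_pdivlMr// divff// gt_eqF.
Qed.

(** Used for [T] and for the identity, to expand both sides of the contraction inequality at the
    same test vector. *)
Lemma quad_delta_pair M i j t (x : 'rV_n := delta_mx 0 i + t *: delta_mx 0 j) :
  (x *m M *m x^t*) 0 0 =
  M i i + t^* * M i j + t * M j i + t * t^* * M j j.
Proof.
have -> : x^t* = delta_mx i 0 + t^* *: delta_mx j 0.
  apply/matrixP => k l.
  by rewrite !mxE rmorphD rmorphM !rmorph_nat ord1 !eqxx !andbT.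
rewrite mulmxDl mulmxDr !mulmxDl -!scalemxAl -!scalemxAr -!rowE -!colE !mxE.
ring.
Qed.

Lemma trig_num_contraction_diag T : is_trig_mx T -> num_contraction T ->
  (forall i, `|T i i| = 1) -> is_diag_mx T.
Proof.
move=> /is_trig_mxP Ttrig Tc T1; apply/is_diag_mxP => i j.
have [ij _|ji _|//] := ltngtP i j; first exact: Ttrig.
set a := T i i; set b := T i j; set c := T j j; set s := `|b| ^+ 2.
(* This phase makes [t^* b] a positive multiple [s / 4] of [a], a first-order
   gain over [|a| = 1], while the other terms are quadratic in [t]. *)
pose t := 4^-1 * (a^* * b).
have aa : a * a^* = 1 by rewrite -normCK T1 expr1n.
have tJ : t^* = 4^-1 * (a * b^*).
  by rewrite /t !rmorphM fmorphV rmorph_nat /= conjCK.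
have bb : b * b^* = s by rewrite -normCK.
have tt : t * t^* = s / 16.
  rewrite tJ /t -bb; transitivity (a * a^* * (b * b^*) / 16).
    by field.
  by rewrite aa; ring.
have := Tc (delta_mx 0 i + t *: delta_mx 0 j).
rewrite -[X in _ <= (X *m _) _ _]mulmx1 !quad_delta_pair (Ttrig j i)// !mxE !eqxx.
have /negbTE ji' : j != i by rewrite -val_eqE /= ltn_eqF.
rewrite ji' eq_sym ji' /= !mulr0 !addr0 mulr1 tt -/a -/b -/c.
have -> : t^* * b = a * (s / 4) by rewrite tJ -bb; ring.
move=> Tx.
have s0 : 0 <= s by rewrite exprn_ge0.
have c1 : `|s / 16 * c| = s / 16.
  by rewrite normrM /c T1 mulr1 ger0_norm// divr_ge0.
(* The triangle inequality moves the [c] term to the right. The factor 1/4 in [t] makes the gain s/4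
   exceed the total cost s/8, which forces s = 0. *)
have : 1 + s / 4 <= 1 + s / 16 + s / 16.
  have {1}<- : `|a * (1 + s / 4)| = 1 + s / 4.
    by rewrite normrM T1 mul1r ger0_norm// addr_ge0// divr_ge0.
  rewrite -[X in _ <= _ + X]c1 mulrDr mulr1.
  rewrite -[X in `|X| <= _](addrK (s / 16 * c)).
  by apply: le_trans (ler_normB _ _) _; rewrite lerD2r.
rewrite -subr_ge0.
have -> : 1 + s / 16 + s / 16 - (1 + s / 4) = - (s / 8) by field.
rewrite oppr_ge0 pmulr_lle0 ?invr_gt0// => sle0.
have /eqP : s = 0 by apply/le_anti/andP.
by rewrite sqrf_eq0 normr_eq0 => /eqP.
Qed.

Lemma num_contraction_inv_unitary M N : M *m N = 1%:M ->
  num_contraction M -> num_contraction N -> M \is unitarymx.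
Proof.
(* The Schur form requires positive size; in size 0 unitarity is vacuous. *)
have [n0 _ _ _|n_gt0 MN Mc Nc] := posnP n.
  by apply/unitarymxP/matrixP => i; have := ltn_ord i; rewrite [X in (_ < X)%N]n0.
(* An eigenvector of [M] for [a] is one of [N] for the inverse of [a], so both [a] and its inverse
   have modulus at most 1. *)
have eigM a : eigenvalue M a -> `|a| = 1.
  move=> aM; apply/le_anti; rewrite (eigenvalue_num_contraction Mc aM) /=.
  have /eigenvalueP[v vM v0] := aM.
  have vE : v = a *: (v *m N) by rewrite scalemxAl -vM -mulmxA MN mulmx1.
  have a0 : a != 0 by apply: contraNneq v0 => a0; rewrite vE a0 scale0r.
  have : eigenvalue N a^-1.
    by apply/eigenvalueP; exists v => //; rewrite {2}vE scalerA mulVf// scale1r.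
  move=> /(eigenvalue_num_contraction Nc).
  by rewrite normfV invf_le1// normr_gt0.
have [P Pu] := Schur M n_gt0; rewrite /similar_to conjymx// => Ttrig.
set T := P *m M *m P^t* in Ttrig.
have Tc : num_contraction T by exact: num_contraction_unitary_similar.
have PP : P *m P^t* = 1%:M by exact/unitarymxP.
have PP' : P^t* *m P = 1%:M by exact: mulmx1C.
have ME : M = P^t* *m T *m P.
  by rewrite /T !mulmxA PP' mul1mx -mulmxA PP' mulmx1.
(* Diagonal entries of a triangular matrix are roots of its characteristic polynomial, and
   similarity carries these eigenvalues back to [M]. *)
have T1 i : `|T i i| = 1.
  apply: eigM; apply: (@eigenvalue_conjmx _ _ _ P).
  - exact/stablemx_unit/unitarymx_unit.
  - by rewrite row_free_unit unitarymx_unit.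
  rewrite conjymx// -/T [_ \in _]eigenvalue_root_char char_poly_trig//.
  by rewrite /root horner_prod (bigD1 i)//= hornerXsubC subrr mul0r.
have Tu : T \is unitarymx.
  have /diag_mxP[D TD] := trig_num_contraction_diag Ttrig Tc T1.
  apply/unitarymxP/matrixP => i j; rewrite TD.
  rewrite tr_diag_mx map_diag_mx mul_diag_mx !mxE.
  have := T1 i; rewrite TD !mxE eqxx mulr1n => D1.
  by case: eqVneq => _; rewrite ?mulr0//= -normCK D1 expr1n.
have Pu' : P^t* \is unitarymx by rewrite trmxC_unitary.
by rewrite ME; do 2!apply: mul_unitarymx => //.
Qed.

End NumericalContraction.

(** * Transfer between tensors and matrices *)

Section TensorMatrix.
Variables (R : realType) (N : nat) (d : 'I_N -> nat).
Implicit Types (A B : sqtensor R d) (X : tensor R d).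
Local Notation n := #|midx d|.

Definition mxten A : 'M[R[i]]_n := \matrix_(i, j) A (enum_val i, enum_val j).

Lemma mxten_inj : injective mxten.
Proof.
move=> A B /matrixP AB; apply/ffunP => -[i j].
by have := AB (enum_rank i) (enum_rank j); rewrite !mxE !enum_rankK.
Qed.

Lemma sum_midx (F : midx d -> R[i]) : \sum_i F i = \sum_(k < n) F (enum_val k).
Proof. by rewrite (reindex (@enum_val _ (midx d)))//; exact/onW_bij/enum_val_bij. Qed.

Lemma mxten_einstein A B : mxten (einstein A B) = mxten A *m mxten B.
Proof.
apply/matrixP => i j; rewrite !mxE ffunE sum_midx.
by apply: eq_bigr => k _; rewrite !mxE.
Qed.

Lemma mxten_id : mxten (idtensor R d) = 1%:M.
Proof.
apply/matrixP => i j; rewrite !mxE ffunE /= -(inj_eq enum_val_inj).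
case: eqVneq => [->|ij]; first by rewrite big1// => r _; rewrite eqxx.
have /existsP[r rij] : [exists r, enum_val i r != enum_val j r].
  apply: contraNT ij; rewrite negb_exists => /forallP ij.
  by apply/eqP/ffunP => r; apply/eqP; rewrite -[_ == _]negbK.
by rewrite (bigD1 r)//= (negbTE rij) mul0r.
Qed.

Lemma mxten_ctranspose A : mxten (ctranspose A) = (mxten A)^t*.
Proof. by apply/matrixP => i j; rewrite !mxE ffunE. Qed.

(** One equation suffices because a right inverse of a square matrix is also a left inverse. *)
Lemma is_inverseP A B : is_inverse A B <-> mxten A *m mxten B = 1%:M.
Proof.
rewrite -mxten_einstein -mxten_id; split=> [[-> //]|/mxten_inj AB]; split=> //.
apply: mxten_inj; move/(congr1 mxten): AB.
by rewrite !mxten_einstein mxten_id; exact: mulmx1C.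
Qed.

Lemma unitary_tensorE A : unitary_tensor A <-> mxten A \is unitarymx.
Proof.
(* Passing to the adjoint turns [unitarymx] into the first tensor equation. *)
rewrite -trmxC_unitary -mxten_ctranspose; split.
  move=> [/(congr1 mxten)]; rewrite mxten_einstein mxten_id => h _.
  by apply/unitarymxP; rewrite mxten_ctranspose trmxCK -mxten_ctranspose.
by move/unitarymxP; rewrite {2}mxten_ctranspose trmxCK => /is_inverseP[].
Qed.

(* Conjugated so that <A X, X> becomes the Hermitian form x M x^* on row vectors. *)
Definition rvten X : 'rV[R[i]]_n := \row_i (X (enum_val i))^*.

Lemma rvten_surj x : exists X, rvten X = x.
Proof.
exists [ffun i => (x 0 (enum_rank i))^*]; apply/rowP => i.
by rewrite mxE ffunE enum_valK conjCK.
Qed.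

Lemma tdot_rvten X : tdot X X = (rvten X *m (rvten X)^t*) 0 0.
Proof.
rewrite mxE /tdot sum_midx; apply: eq_bigr => k _.
by rewrite !mxE conjCK mulrC.
Qed.

Lemma tdot_app_rvten A X :
  tdot (einstein_app A X) X = (rvten X *m mxten A *m (rvten X)^t*) 0 0.
Proof.
rewrite -mulmxA mxE /tdot sum_midx; apply: eq_bigr => k _.
rewrite mxE mulrC ffunE sum_midx mxE; congr (_ * _).
by apply: eq_bigr => l _; rewrite !mxE conjCK.
Qed.

Lemma tnorm_eq1 X : tnorm X = 1 <-> tdot X X = 1.
Proof.
rewrite /tnorm; split=> [h|->]; last by rewrite sqrtC1.
by rewrite -[LHS]sqrtCK h expr1n.
Qed.

Lemma numerical_radius_le1 A : (forall k, (0 < d k)%N) ->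
  numerical_radius A <= 1 <-> num_contraction (mxten A).
Proof.
(* Positive dimensions ensure that the maximum is attained, so the radius is not merely the default
   0. *)
move=> d_gt0; have [[_ [X /tnorm_eq1 X1 <-] wE] w_ub] := numerical_radiusP A d_gt0.
have normc_le1 (z : R[i]) : (ComplexField.Normc.normc z <= 1) = (`|z| <= 1).
  by rewrite -lecR.
split=> [w1 x|Ac]; last first.
  by rewrite -wE normc_le1 tdot_app_rvten -X1 tdot_rvten.
have [->|x0] := eqVneq x 0; first by rewrite !mul0mx mxE normr0.
have xx : 0 < (x *m x^t*) 0 0 by rewrite -dotmxE dnorm_gt0.
set r := (x *m x^t*) 0 0 in xx *.
(* [Y] is the unit tensor obtained by normalising [x]; its form is that of [x] divided by [r]. *)
have [Y Yx] := rvten_surj ((sqrtC r)^-1 *: x).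
have cc : (sqrtC r)^-1 * ((sqrtC r)^-1)^* = r^-1.
  by rewrite -normCK normfV exprVn ger0_norm ?sqrtCK// sqrtC_ge0 ltW.
have YJ : (rvten Y)^t* = ((sqrtC r)^-1)^* *: x^t*.
  by rewrite Yx; apply/matrixP => i j; rewrite !mxE rmorphM.
have Y1 : tdot Y Y = 1.
  by rewrite tdot_rvten YJ Yx -scalemxAl -scalemxAr scalerA mxE cc mulVf// gt_eqF.
have : ComplexField.Normc.normc (tdot (einstein_app A Y) Y) <= 1.
  apply: le_trans w1; apply: w_ub; exists (tdot (einstein_app A Y) Y) => //.
  by exists Y => //; exact/tnorm_eq1.
rewrite normc_le1 tdot_app_rvten YJ Yx -!scalemxAl -scalemxAr scalerA mxE cc.
by rewrite normrM normfV (gtr0_norm xx) mulrC ler_pdivrMr// mul1r.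
Qed.

End TensorMatrix.

Theorem theorem4p7 (R : realType) (N : nat) (d : 'I_N -> nat)
    (hN : (0 < N)%N) (hd : forall k : 'I_N, (0 < d k)%N) (A : sqtensor R d) :
  (invertible_tensor A /\ numerical_radius A <= 1 /\
   numerical_radius (tensor_inv A) <= 1)
  <-> unitary_tensor A.
Proof.
rewrite !numerical_radius_le1//.
(* Invertibility rules out the default value of [tensor_inv]. *)
have invP : invertible_tensor A -> mxten A *m mxten (tensor_inv A) = 1%:M.
  by move=> Ainv; apply/is_inverseP; exact: (xgetPex 0 Ainv).
split=> [[Ainv [Ac Bc]]|Au].
  by apply/unitary_tensorE; exact: num_contraction_inv_unitary (invP Ainv) Ac Bc.
have Ainv : invertible_tensor A by exists (ctranspose A); case: Au.
move/unitary_tensorE: Au => Mu; split=> //; split; first exact: unitary_num_contraction.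
(* Uniqueness of inverses identifies the chosen inverse with the adjoint. *)
have -> : mxten (tensor_inv A) = (mxten A)^t*.
  rewrite -[LHS]mul1mx.
  have /mulmx1C <- : mxten A *m (mxten A)^t* = 1%:M by exact/unitarymxP.
  by rewrite -mulmxA invP// mulmx1.
by apply: unitary_num_contraction; rewrite trmxC_unitary.
Qed.
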